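(* Let $G$ and $H$ be nontrivial connected graphs. The exponential graph $G^H$ is super edge-connected if and only if both of the following hold: (i) $\delta(G)\ge 2$ or $H$ is not a complete graph; and (ii) $\delta(H)\ge 2$ or $G$ is not a complete graph.
   Context: A graph means a finite simple undirected graph with at least one vertex; it is nontrivial if it has at least two vertices. $\delta(G)$ is the minimum degree of $G$ and $N_G(u)$ is the set of neighbours of $u$. For a connected graph $G$, a set $F\subseteq E(G)$ is an edge-cut if $G-F$ is disconnected; a minimum edge-cut is an edge-cut of minimum cardinality. A graph $G$ is super edge-connected if every minimum edge-cut of $G$ isolates a vertex, i.e., for every minimum edge-cut $F$ there is a vertex $u$ with $\deg_G(u)=\delta(G)$ such that $F=\{uv\in E(G) : v\in N_G(u)\}$. Exponential graph: for graphs $G$ and $H$ with $V(H)=\{w_1,\ldots,w_q\}$, the exponential graph $G^H$ has vertex set $\{(u_1,\ldots,u_q;w_j) : u_i\in V(G)\ (1\le i\le q),\ 1\le j\le q\}$, and two vertices $(u_1,\ldots,u_q;w_j)$ and $(v_1,\ldots,v_q;w_k)$ are adjacent if and only if either ($j=k$, $u_jv_j\in E(G)$, and $u_i=v_i$ for all $i\ne j$) or ($j\neq k$, $w_jw_k\in E(H)$, and $u_i=v_i$ for all $i$). *)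

(* Defs.v *)
From mathcomp Require Import all_boot.
Set Implicit Arguments.
Unset Strict Implicit.
Unset Printing Implicit Defensive.

Record sgraph := SGraph {
  svertex :> finType;
  sedge : rel svertex;
  sedge_sym : symmetric sedge;
  sedge_irr : irreflexive sedge;
  svertex_gt0 : 0 < #|svertex| }.

Notation "x -- y" := (sedge x y) (at level 30, no associativity).

Definition nontrivial (G : sgraph) := 1 < #|G|.

Definition connected (G : sgraph) :=
  [forall x : G, forall y : G, connect (@sedge G) x y].

Definition complete (G : sgraph) :=
  [forall x : G, forall y : G, (x != y) ==> x -- y].

Definition neighbours (G : sgraph) (u : G) : {set G} := [set v | u -- v].

Definition deg (G : sgraph) (u : G) := #|neighbours u|.

(* A degree is always smaller than #|G|, so the default value of the iterated
   minimum is never attained; see [min_deg_le] and [min_deg_attained]. *)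
Definition min_deg (G : sgraph) := \big[minn/#|G|]_(u : G) deg u.

(* An edge is the unordered pair of its endpoints. *)
Definition edges (G : sgraph) : {set {set G}} :=
  [set [set x; y] | x in G, y in neighbours x].

Section DeleteEdges.
Variables (G : sgraph) (F : {set {set G}}).

Definition del_rel : rel G := [rel x y | (x -- y) && ([set x; y] \notin F)].

Fact del_rel_sym : symmetric del_rel.
Proof. by move=> x y; rewrite /del_rel /= sedge_sym setUC. Qed.

Fact del_rel_irr : irreflexive del_rel.
Proof. by move=> x; rewrite /del_rel /= sedge_irr. Qed.

Definition del_edges : sgraph :=
  SGraph del_rel_sym del_rel_irr (svertex_gt0 G).
End DeleteEdges.

Definition edge_cut (G : sgraph) (F : {set {set G}}) :=
  (F \subset edges G) && ~~ connected (del_edges F).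

Definition min_edge_cut (G : sgraph) (F : {set {set G}}) :=
  edge_cut F /\ forall F' : {set {set G}}, edge_cut F' -> #|F| <= #|F'|.

Definition super_edge_connected (G : sgraph) :=
  forall F : {set {set G}}, min_edge_cut F ->
    exists u : G, deg u = min_deg G /\
      F = [set [set u; v] | v in neighbours u].

Section Exponential.
Variables G H : sgraph.

(* The q-tuples of vertices of G are indexed by the vertices of H themselves
   rather than by an enumeration w_1, ..., w_q of them. *)
Definition exp_rel : rel ({ffun H -> G} * H) :=
  [rel x y : {ffun H -> G} * H |
    [&& x.2 == y.2, x.1 x.2 -- y.1 x.2 &
        [forall i, (i != x.2) ==> (x.1 i == y.1 i)]]
    || [&& x.2 != y.2, x.2 -- y.2 & x.1 == y.1]].

Fact exp_rel_sym : symmetric exp_rel.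
Proof.
move=> x y; rewrite /exp_rel /= [y.1 == x.1]eq_sym [y.2 -- x.2]sedge_sym.
case: eqVneq => //= ->; rewrite !orbF [y.1 _ -- _]sedge_sym; congr (_ && _).
by apply: eq_forallb => i; rewrite [x.1 i == _]eq_sym.
Qed.

Fact exp_rel_irr : irreflexive exp_rel.
Proof. by move=> x; rewrite /exp_rel /= !sedge_irr !andbF. Qed.

Fact exp_gt0 : 0 < #|{: {ffun H -> G} * H}|.
Proof.
by rewrite card_prod card_ffun muln_gt0 expn_gt0 !svertex_gt0.
Qed.

Definition exp_graph : sgraph := SGraph exp_rel_sym exp_rel_irr exp_gt0.
End Exponential.

Lemma deg_ltn (G : sgraph) (u : G) : deg u < #|G|.
Proof.
rewrite /deg -cardsT; apply: proper_card.
apply/properP; split; first exact: subsetT.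
by exists u; rewrite inE ?sedge_irr.
Qed.

Lemma min_deg_le (G : sgraph) (u : G) : min_deg G <= deg u.
Proof.
rewrite /min_deg; elim: (index_enum G) (mem_index_enum u) => [//|v s IHs].
rewrite inE big_cons => /predU1P[<-|/IHs]; first exact: geq_minl.
exact: leq_trans (geq_minr _ _).
Qed.

Lemma min_deg_attained (G : sgraph) : exists u : G, deg u = min_deg G.
Proof.
have [u0 _] : exists u0, u0 \in G by apply/card_gt0P; exact: svertex_gt0.
have : min_deg G = #|G| \/ exists u : G, deg u = min_deg G.
  rewrite /min_deg; elim/big_ind: _; first by left.
  - by move=> m n Hm Hn; rewrite /minn; case: ifP.
  - by move=> u _; right; exists u.
by case=> // E; have := leq_ltn_trans (min_deg_le u0) (deg_ltn u0); rewrite E ltnn.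
Qed.

(* Main.v *)
(* An edge cut of minimum size is the set of edges between a vertex set B and its
   complement, and G^H is edge-partitioned into copies of H (one for each f) and
   copies of G (one for each direction k and each line of tuples in direction k).
   A copy meeting both B and its complement contributes at least one cut edge.
   Fixing one coordinate i of f yields |G| disjoint slices.
   - If for some i no slice is contained in B or in its complement, each of them
     contributes at least delta(H) edges, and |G| delta(H) > delta(G) + delta(H)
     by (ii).
   - Otherwise every direction has a slice in, say, the complement of B, so no
     copy of G is contained in B. If B contains a copy of H, each of the edges
     leaving it can be charged a different cut edge, and there are at least
     |H| delta(G) > delta(G) + delta(H) of them by (i). If not, every copy
     meeting B is cut; charging each neighbour y in B of a vertex x in B to the
     copy of the other kind through y shows that the cut has at least
     deg x >= delta(G) + delta(H) edges, and strictly more unless B = {x}.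
   Conversely, if (i) or (ii) fails, a copy of H, respectively of G, is separated
   by delta(G) + delta(H) pairwise disjoint edges. *)
Require Import Defs.
From mathcomp Require Import all_boot zify.
Set Implicit Arguments.
Unset Strict Implicit.
Unset Printing Implicit Defensive.

(** * Edge boundaries of vertex sets, and edge-cuts of a graph *)

Section Cut.
Variable G : sgraph.
Implicit Types A : {set G}.

(** An edge leaving [A] has exactly one end in [A], so it is counted once. *)
Definition cut A := \sum_(x in A) #|neighbours x :\: A|.

Definition boundary A : {set {set G}} :=
  [set [set x; y] | x in A, y in neighbours x :\: A].

Lemma cutE A : cut A = \sum_(x in A) \sum_(y | y \notin A) (x -- y).
Proof.
apply: eq_bigr => x _; rewrite -sum1_card big_mkcond [RHS]big_mkcond /=.
by apply: eq_bigr => y _; rewrite !inE; case: (y \in A); case: (x -- y).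
Qed.

Lemma cut_setC A : cut (~: A) = cut A.
Proof.
rewrite !cutE exchange_big /=; apply: eq_big => [y|y _]; rewrite ?inE ?negbK //.
by apply: eq_big => x; rewrite ?inE // sedge_sym.
Qed.

Lemma cut1 (x : G) : cut [set x] = deg x.
Proof.
rewrite /cut big_set1 /deg; congr #|pred_of_set _|; apply/setP => y; rewrite !inE.
by case: eqVneq => // ->; rewrite sedge_irr.
Qed.

Lemma cut_gt0 A : connected G -> A != set0 -> A != setT -> 0 < cut A.
Proof.
move=> /forallP cG /set0Pn[x xA] AT; rewrite lt0n; apply: contra AT => /eqP cut0.
have Acl : closed (@sedge G) (mem A).
  apply: intro_closed => [|u v uv uA]; first exact: sym_connect_sym (@sedge_sym G).
  move/eqP: cut0; rewrite sum_nat_eq0 => /forallP/(_ u)/implyP/(_ uA).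
  by rewrite cards_eq0 setD_eq0 => /subsetP/(_ v); rewrite inE; apply.
apply/eqP/setP => y; rewrite inE.
by rewrite -(closed_connect Acl (forallP (cG x) y)).
Qed.

Lemma degD_le A (x : G) : x \in A -> deg x < #|neighbours x :\: A| + #|A|.
Proof.
move=> xA; rewrite /deg -(cardsID A) addnC ltn_add2l.
apply: proper_card; apply/properP; split; first exact: subsetIr.
by exists x => //; rewrite !inE sedge_irr.
Qed.

Lemma cut_deg A (x : G) : x \in A -> deg x < cut A + #|A|.
Proof.
move=> xA; apply: leq_trans (degD_le xA) _.
by rewrite leq_add2r /cut (bigD1 x) //= leq_addr.
Qed.

Lemma cut_min_deg A : A != set0 -> min_deg G < cut A + #|A|.
Proof. by case/set0Pn=> x /cut_deg; apply/leq_ltn_trans/min_deg_le. Qed.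

(** If [#|A|] exceeds the minimum degree d, one cut edge is enough. Otherwise two members of [A]
    each send at least d + 1 - [#|A|] edges out, and 2(d + 1 - [#|A|]) + [#|A|] is at least d +
    2. *)
Lemma cut_min_degS A : connected G -> A != setT -> 1 < #|A| ->
  (min_deg G).+1 < cut A + #|A|.
Proof.
move=> cG AT A1; have A0 : A != set0 by rewrite -card_gt0 ltnW.
have cA := cut_gt0 cG A0 AT.
case: (ltnP (min_deg G) #|A|) => [|Ad]; first lia.
have /card_gt1P[x [y [xA yA xy]]] := A1.
have : #|neighbours x :\: A| + #|neighbours y :\: A| <= cut A.
  rewrite /cut (bigD1 x) //= leq_add2l (bigD1 y) ?yA 1?eq_sym //=.
  exact: leq_addr.
have := degD_le xA; have := degD_le yA.
have := min_deg_le x; have := min_deg_le y; lia.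
Qed.

Lemma card_boundary A : #|boundary A| = cut A.
Proof.
pose D := [set z : G * G | (z.1 \in A) && (z.2 \in neighbours z.1 :\: A)].
have -> : boundary A = [set [set z.1; z.2] | z in D].
  apply/setP => e; apply/imset2P/imsetP => [[x y xA yA ->]|[[x y]]].
    by exists (x, y) => //; rewrite inE xA.
  by rewrite inE => /andP[xA yA] ->; exists x y.
rewrite card_in_imset => [|[x y] [x' y']].
  rewrite -sum1_card (eq_bigl (fun z => (z.1 \in A) && (z.2 \in neighbours z.1 :\: A))).
    by rewrite -(pair_big_dep (mem A) (fun x y => y \in neighbours x :\: A) (fun _ _ => 1)) /=;
       apply: eq_bigr => x _; rewrite sum1_card.
  by move=> z; rewrite inE.
rewrite !inE /= => /and3P[xA yA _] /and3P[x'A y'A _] E.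
have := set21 x y; have := set22 x y; rewrite E !inE.
move=> /orP[/eqP Ey|/eqP->]; first by rewrite Ey x'A in yA.
by move=> /orP[/eqP->|/eqP Ex] //; rewrite -Ex xA in y'A.
Qed.

Lemma boundary_setC A : boundary (~: A) = boundary A.
Proof.
by apply/setP => e; apply/imset2P/imset2P => -[x y];
  rewrite !inE ?negbK => xA /andP[yA xy] ->; exists y x; rewrite 1?setUC ?inE ?xA ?yA ?negbK // sedge_sym.
Qed.

Lemma boundary1 (x : G) : boundary [set x] = [set [set x; v] | v in neighbours x].
Proof.
apply/setP => e; apply/imset2P/imsetP => [[u y]|[y xy ->]].
  by rewrite !inE => /eqP-> /andP[_ xy] ->; exists y; rewrite ?inE.
exists x y; rewrite ?inE //; rewrite inE in xy; rewrite xy andbT.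
by apply: contraTneq xy => ->; rewrite sedge_irr.
Qed.

Lemma edge_cut_boundary A : A != set0 -> A != setT -> edge_cut (boundary A).
Proof.
move=> /set0Pn[x xA] AT; apply/andP; split.
  apply/subsetP => e /imset2P[u v uA]; rewrite inE => /andP[vA uv] ->.
  by apply/imset2P; exists u v.
apply: contra AT => /forallP/(_ x)/forallP cF; apply/eqP/setP => y; rewrite inE.
have Acl : closed (@sedge (del_edges (boundary A))) (mem A).
  apply: intro_closed => [|u v /andP[uv]].
    exact: sym_connect_sym (@sedge_sym (del_edges _)).
  move=> uvF uA; apply: contraR uvF => vA; apply/imset2P; exists u v => //.
  by rewrite !inE uv andbT.
by rewrite -(closed_connect Acl (cF y)).
Qed.

Lemma edge_cut_sub (F : {set {set G}}) : edge_cut F ->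
  exists A, [/\ A != set0, A != setT & boundary A \subset F].
Proof.
case/andP=> _ /forallPn[x /forallPn[y xy]].
(* The component of [x] in [G] minus [F]: every edge leaving it was deleted. *)
exists [set z | connect (@sedge (del_edges F)) x z]; split.
- by apply/set0Pn; exists x; rewrite inE connect0.
- by apply: contra xy => /eqP/setP/(_ y); rewrite !inE => ->.
apply/subsetP => e /imset2P[u v]; rewrite !inE => xu /andP[xv uv] ->.
apply: contraR xv => uvF; apply: connect_trans xu (connect1 _).
by apply/andP.
Qed.

Lemma edge_cut_star (u : G) : nontrivial G ->
  edge_cut [set [set u; v] | v in neighbours u].
Proof.
move=> ntG; rewrite -boundary1; apply: edge_cut_boundary.
  by rewrite -card_gt0 cards1.
by apply: contraTneq ntG => E; rewrite /nontrivial -cardsT -E cards1.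
Qed.

Lemma card_star (u : G) : #|[set [set u; v] | v in neighbours u]| = deg u.
Proof. by rewrite -boundary1 card_boundary cut1. Qed.

(** A minimum edge-cut contains the boundary of some [A], itself an edge-cut, and so equals it;
    stars bound its size by the minimum degree. *)
Lemma super_edge_connected_cut : nontrivial G ->
  (forall A, A != set0 -> A != setT -> cut A <= min_deg G ->
     exists u, A = [set u] \/ ~: A = [set u]) ->
  super_edge_connected G.
Proof.
move=> ntG sing F [Fc Fmin]; have [A [A0 AT AF]] := edge_cut_sub Fc.
have EF : boundary A = F.
  by apply/eqP; rewrite eqEcard AF Fmin ?edge_cut_boundary.
have [w dw] := min_deg_attained G.
have Fd : #|F| <= min_deg G by rewrite -dw -card_star Fmin ?edge_cut_star.
have [u Au] : exists u, boundary A = boundary [set u].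
  case: (sing A A0 AT) => [|u [->|Au]]; first by rewrite -card_boundary EF.
    by exists u.
  by exists u; rewrite -Au boundary_setC.
rewrite boundary1 EF in Au; exists u; split=> //.
by apply/eqP; rewrite eqn_leq min_deg_le -card_star -Au Fd.
Qed.

Lemma super_boundary A : super_edge_connected G -> nontrivial G ->
  A != set0 -> A != setT -> cut A <= min_deg G ->
  exists u : G, boundary A = [set [set u; v] | v in neighbours u].
Proof.
move=> sG ntG A0 AT cA.
have Ac := edge_cut_boundary A0 AT.
(* A smallest edge-cut [F0] is a star of minimum degree, so the boundary of [A], being no larger, is
   also minimum. *)
have [F0 F0c F0min] := arg_minnP (fun F : {set {set G}} => #|F|) Ac.
have [u [du F0u]] := sG F0 (conj F0c F0min).
have [|v [_ ->]] := sG (boundary A); last by exists v.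
split=> // F Fc; apply: leq_trans (F0min F Fc).
by rewrite card_boundary F0u card_star du.
Qed.

Lemma min_deg_gt0 : nontrivial G -> connected G -> 0 < min_deg G.
Proof.
move=> ntG cG; have [u <-] := min_deg_attained G; rewrite -cut1.
apply: cut_gt0 => //; first by rewrite -card_gt0 cards1.
by apply: contraTneq ntG => E; rewrite /nontrivial -cardsT -E cards1.
Qed.

Lemma complete_min_deg : complete G -> (min_deg G).+1 = #|G|.
Proof.
move=> /forallP cG; have [u <-] := min_deg_attained G.
rewrite -cardsT (cardsD1 u) inE add1n /deg; congr (#|pred_of_set _|.+1).
apply/setP => v; rewrite !inE andbT; apply/idP/idP => [|vu].
  by apply: contraTneq => ->; rewrite sedge_irr.
by have /forallP/(_ v) := cG u; rewrite eq_sym vu.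
Qed.

Lemma not_complete_min_deg : ~ complete G -> (min_deg G).+1 < #|G|.
Proof.
move/negP=> /forallPn[u /forallPn[v]]; rewrite negb_imply => /andP[uv nuv].
apply: leq_ltn_trans (_ : (deg u).+1 < _); first by rewrite ltnS min_deg_le.
rewrite -cardsT (cardsD1 u) inE add1n ltnS; apply: proper_card.
apply/properP; split; last by exists v; rewrite !inE ?andbT 1?eq_sym.
by apply/subsetP => w; rewrite !inE andbT; apply: contraTneq => ->; rewrite sedge_irr.
Qed.

End Cut.

(** * Copies of G and H in the exponential graph, and its degrees *)

Section ExpCut.
Variables G H : sgraph.
Local Notation F := {ffun H -> G}.
Local Notation X := (exp_graph G H).
Implicit Types (f g b : F) (k l j : H) (u v : G) (B : {set X}) (J : {set H}).

Definition upd f k u : F := [ffun i => if i == k then u else f i].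

Lemma upd_same f k u : upd f k u k = u.
Proof. by rewrite ffunE eqxx. Qed.

Lemma upd_other f k u l : l != k -> upd f k u l = f l.
Proof. by rewrite ffunE => /negbTE->. Qed.

Lemma upd_id f k : upd f k (f k) = f.
Proof. by apply/ffunP => i; rewrite ffunE; case: eqVneq => // ->. Qed.

Lemma upd_upd f k u v : upd (upd f k u) k v = upd f k v.
Proof. by apply/ffunP => i; rewrite !ffunE; case: eqVneq. Qed.

(* The traces of [B] on the copy of [H] indexed by [f], and on the copy of [G]
   through [(f, k)], in which only the coordinate [k] of [f] varies. *)
Definition fibH B f : {set H} := [set k | ((f, k) : X) \in B].
Definition fibG B f k : {set G} := [set u | ((upd f k u, k) : X) \in B].

Lemma fibG_upd B f k u : fibG B (upd f k u) k = fibG B f k.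
Proof. by apply/setP => v; rewrite !inE upd_upd. Qed.

Lemma fibG_mem B f k : (f k \in fibG B f k) = (((f, k) : X) \in B).
Proof. by rewrite inE upd_id. Qed.

Lemma fibH_setC B f : fibH (~: B) f = ~: fibH B f.
Proof. by apply/setP => k; rewrite !inE. Qed.

Lemma fibG_setC B f k : fibG (~: B) f k = ~: fibG B f k.
Proof. by apply/setP => k'; rewrite !inE. Qed.

Lemma adjH f k k' : sedge ((f, k) : X) ((f, k') : X) = k -- k'.
Proof.
rewrite /= /exp_rel /= sedge_irr andbF /= eqxx andbT.
by case: eqVneq => // ->; rewrite sedge_irr.
Qed.

Lemma adjG f k u : sedge ((f, k) : X) ((upd f k u, k) : X) = f k -- u.
Proof.
rewrite /= /exp_rel /= eqxx upd_same /= orbF; case: (_ -- _) => //=.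
by apply/forallP => i; apply/implyP => ik; rewrite upd_other.
Qed.

Lemma nbr_expD B f k :
  #|neighbours ((f, k) : X) :\: B| =
  #|neighbours k :\: fibH B f| + #|neighbours (f k) :\: fibG B f k|.
Proof.
pose P := [set ((f, k') : X) | k' in neighbours k :\: fibH B f].
pose Q := [set ((upd f k u, k) : X) | u in neighbours (f k) :\: fibG B f k].
have <- : #|P| = #|neighbours k :\: fibH B f| by apply: card_imset => x y [].
have <- : #|Q| = #|neighbours (f k) :\: fibG B f k|.
  by apply: card_imset => x y [] /(congr1 (fun h : F => h k)); rewrite !upd_same.
have PQ : P :&: Q = set0.
  apply/setP => z; rewrite !inE; apply/negP => /andP[/imsetP[k' kk' ->]].
  case/imsetP=> u _ [_ Ek]; move: kk'.
  by rewrite Ek !inE sedge_irr andbF.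
rewrite -cardsUI PQ cards0 addn0; congr #|pred_of_set _|.
apply/setP => -[h l]; rewrite in_setU in_setD inE; apply/andP/orP.
  case=> hB; rewrite /= /exp_rel /= => /orP[/and3P[/eqP kl fh /forallP E]|/and3P[kl kl' /eqP fh]].
    right; apply/imsetP; exists (h k); last first.
      congr pair => //; apply/ffunP => i; rewrite ffunE; case: eqVneq => [->//|ik].
      by have := E i; rewrite ik => /eqP.
    have Eh : h = upd f k (h k).
      apply/ffunP => i; rewrite ffunE; case: eqVneq => [->//|ik].
      by have := E i; rewrite ik => /eqP.
    by rewrite !inE fh andbT -Eh kl.
  by left; apply/imsetP; exists l; rewrite ?inE ?kl' ?andbT fh.
case=> /imsetP[z]; rewrite !inE => /andP[zB kz] ->.
  by rewrite zB adjH.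
by rewrite zB adjG.
Qed.

Lemma deg_exp f k : deg ((f, k) : X) = deg k + deg (f k).
Proof.
have f0 : fibH set0 f = set0 by apply/setP => l; rewrite !inE.
have g0 : fibG set0 f k = set0 by apply/setP => u; rewrite !inE.
by have := nbr_expD set0 f k; rewrite f0 g0 !setD0.
Qed.

Lemma min_deg_exp : min_deg X = min_deg G + min_deg H.
Proof.
apply/eqP; rewrite eqn_leq; apply/andP; split.
  have [u <-] := min_deg_attained G; have [k <-] := min_deg_attained H.
  by rewrite addnC; have := min_deg_le (([ffun => u], k) : X); rewrite deg_exp ffunE.
have [[f k]] := min_deg_attained X; rewrite deg_exp addnC => <-.
by rewrite leq_add ?min_deg_le.
Qed.

(** * Counting cut edges inside subcubes with free coordinates [J] *)

Definition cube J b : {set F} :=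
  [set f : F | [forall k, (k \notin J) ==> (f k == b k)]].

Lemma cubeP J b f : reflect (forall k, k \notin J -> f k = b k) (f \in cube J b).
Proof.
rewrite inE; apply: (iffP forallP) => E k.
  by move=> kJ; apply/eqP; exact: implyP (E k) kJ.
by apply/implyP => kJ; rewrite E.
Qed.

Lemma cube_upd J b f k u : k \in J -> (upd f k u \in cube J b) = (f \in cube J b).
Proof.
move=> kJ; apply/cubeP/cubeP => E l lJ; have lk : l != k by apply: contraNneq lJ => ->.
  by rewrite -E // upd_other.
by rewrite upd_other // E.
Qed.

Lemma cube_slice J b f i u : i \in J ->
  (f \in cube (J :\ i) (upd b i u)) = (f \in cube J b) && (f i == u).
Proof.
move=> iJ; apply/cubeP/andP => [E|[/cubeP E /eqP fi] k].
  split; last by rewrite E ?upd_same // !inE eqxx.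
  apply/cubeP => k kJ; rewrite E ?upd_other //; last by rewrite !inE negb_and kJ orbT.
  by apply: contraNneq kJ => ->.
rewrite !inE negb_and negbK => /orP[/eqP->|kJ]; first by rewrite upd_same.
by rewrite upd_other ?E //; apply: contraNneq kJ => ->.
Qed.

Lemma cube_id J b : b \in cube J b.
Proof. exact/cubeP. Qed.

Lemma cubeT b f : f \in cube setT b.
Proof. by apply/cubeP => k; rewrite inE. Qed.

Definition outG B f k := if ((f, k) : X) \in B then #|neighbours (f k) :\: fibG B f k| else 0.

(* The number of edges between [B] and its complement inside the subgraph of
   the vertices [(f, k)] with [f] in [cube J b]. *)
Definition ecut B J b :=
  \sum_(f in cube J b) (cut (fibH B f) + \sum_(k in J) outG B f k).

Lemma cut_ecut B b : cut B = ecut B setT b.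
Proof.
rewrite /cut /ecut.
rewrite (eq_bigr (fun x : X => #|neighbours x.2 :\: fibH B x.1| + outG B x.1 x.2)); last first.
  by case=> f k fB /=; rewrite nbr_expD /outG fB.
rewrite (eq_bigl (fun x : X => true && (((x.1, x.2) : X) \in B))); last by case.
rewrite -(pair_big_dep xpredT (fun f k => ((f, k) : X) \in B)
  (fun f k => #|neighbours k :\: fibH B f| + outG B f k)) /=.
apply: eq_big => [f|f _]; first by rewrite cubeT.
rewrite big_split /=; congr (_ + _).
  by apply: eq_bigl => k; rewrite inE.
rewrite big_mkcond /=; apply: eq_big => k; first by rewrite inE.
by move=> _; rewrite /outG; case: ifP => // ->.
Qed.

(** Only an inequality: the edges in direction [i], which join different slices, are dropped. *)
Lemma ecut_slices B J b i : i \in J ->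
  \sum_u ecut B (J :\ i) (upd b i u) <= ecut B J b.
Proof.
move=> iJ; rewrite /ecut (partition_big (fun f : F => f i) xpredT) //=.
apply: leq_sum => u _; rewrite (eq_bigl _ _ (fun f => cube_slice b f u iJ)).
apply: leq_sum => f _; rewrite leq_add2l [leqRHS](bigD1 i) //=.
rewrite (eq_bigl (fun k => (k \in J) && (k != i))) ?leq_addl // => k.
by rewrite !inE andbC.
Qed.

Lemma sum_outG B J b k c : k \in J ->
  \sum_(f in cube J b) outG B f k =
  \sum_(f in cube J b | f k == c) cut (fibG B f k).
Proof.
move=> kJ.
(* Tuples with the same [upd f k c] form one copy of G in direction [k]; over it, [outG] sums to the
   cut of that copy. *)
rewrite (partition_big (fun f => upd f k c) (fun g => (g \in cube J b) && (g k == c))) /=; last first.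
  by move=> f fJ; rewrite cube_upd // fJ upd_same eqxx.
apply: eq_bigr => g /andP[gJ /eqP gk].
rewrite (reindex_onto (fun u => upd g k u) (fun f => f k)) /=; last first.
  by move=> f /andP[_ /eqP<-]; rewrite upd_upd upd_id.
rewrite /cut [RHS]big_mkcond /=; apply: eq_big => [u|u _].
  by rewrite cube_upd // gJ upd_same upd_upd -gk upd_id !eqxx.
by rewrite /outG fibG_upd upd_same inE.
Qed.

(* Each copy of [G] in direction [k] is represented by its unique member [f] with
   [f k = g k], so that the copies through [g] itself are represented by [g]. *)
Lemma ecut_base B J b g :
  ecut B J b = \sum_(f in cube J b)
    (cut (fibH B f) + \sum_(k in J | f k == g k) cut (fibG B f k)).
Proof.
rewrite /ecut !big_split /=; congr (_ + _); rewrite exchange_big /=.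
rewrite (exchange_big_dep (mem J)) /=; last by move=> f k _ /andP[].
apply: eq_bigr => k kJ; rewrite (sum_outG _ _ (g k)) //.
by apply: eq_bigl => f; rewrite kJ.
Qed.

(** [outG] is not symmetric under complement, but the cut of each whole copy is, hence the passage
    through [ecut_base]. *)
Lemma ecut_setC B J b : ecut (~: B) J b = ecut B J b.
Proof.
rewrite !(ecut_base _ _ _ b); apply: eq_bigr => f _.
rewrite fibH_setC cut_setC; congr (_ + _).
by apply: eq_bigr => k _; rewrite fibG_setC cut_setC.
Qed.

(** * Pure and mixed slices, and a lower bound for mixed subcubes *)

Definition pure B J b (c : bool) :=
  [forall f, (f \in cube J b) ==> [forall k, (((f, k) : X) \in B) == c]].

Lemma pureP B J b c :
  reflect (forall f k, f \in cube J b -> (((f, k) : X) \in B) = c) (pure B J b c).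
Proof.
apply: (iffP forallP) => [E f k fJ|E f].
  by have /implyP/(_ fJ)/forallP/(_ k)/eqP := E f.
by apply/implyP => fJ; apply/forallP => k; rewrite E.
Qed.

Lemma pure_setC B J b c : pure (~: B) J b c = pure B J b (~~ c).
Proof.
by apply/pureP/pureP => E f k /(E f k) => [|fk];
  rewrite inE; [move=> <-; rewrite negbK | rewrite fk negbK].
Qed.

Definition mixed B J b := ~~ pure B J b true && ~~ pure B J b false.

Lemma mixed_setC B J b : mixed (~: B) J b = mixed B J b.
Proof. by rewrite /mixed !pure_setC andbC. Qed.

Lemma mixedP B J b : reflect
  ((exists f k, f \in cube J b /\ ((f, k) : X) \in B) /\
   (exists f k, f \in cube J b /\ ((f, k) : X) \notin B)) (mixed B J b).
Proof.
rewrite /mixed; apply: (iffP andP).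
  case=> /forallPn[f]; rewrite negb_imply => /andP[fJ /forallPn[k fk]].
  case/forallPn=> f'; rewrite negb_imply => /andP[f'J /forallPn[k' fk']].
  split; first by exists f', k'; split=> //; move: fk'; case: (_ \in B).
  by exists f, k; split=> //; move: fk; case: (_ \in B).
case=> -[f [k [fJ fk]]] [f' [k' [f'J fk']]].
split; apply/negP => /pureP E; first by rewrite E in fk'.
by rewrite E in fk.
Qed.

(* Slices in two different directions intersect, hence pure ones have the same
   colour. *)
Lemma slices_alternative B J b : J != set0 ->
  (exists2 i, i \in J & forall u, mixed B (J :\ i) (upd b i u)) \/
  (exists c, forall i, i \in J -> exists u, pure B (J :\ i) (upd b i u) c).
Proof.
case/set0Pn=> i0 i0J.
case: (boolP [exists i in J, [forall u, mixed B (J :\ i) (upd b i u)]]) => [|nsp].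
  by case/exists_inP=> i iJ /forallP; left; exists i.
right; have pureJ i : i \in J -> exists u c, pure B (J :\ i) (upd b i u) c.
  move=> iJ; move/exists_inPn: nsp => /(_ i iJ)/forallPn[u].
  by rewrite negb_and !negbK => /orP[] ?; exists u; [exists true | exists false].
have [u0 [c p0]] := pureJ i0 i0J; exists c => i iJ.
have [->|ni] := eqVneq i i0; first by exists u0.
have [u [c' p1]] := pureJ i iJ; exists u; suff <- : c' = c by [].
pose f := upd (upd b i0 u0) i u.
have f0 : f \in cube (J :\ i0) (upd b i0 u0).
  by rewrite cube_slice // !cube_upd // cube_id upd_other 1?eq_sym // upd_same eqxx.
have f1 : f \in cube (J :\ i) (upd b i u).
  by rewrite cube_slice // !cube_upd // cube_id upd_same eqxx.
by move/pureP: p0 => /(_ f i f0) <-; move/pureP: p1 => /(_ f i f1) <-.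
Qed.

(** A copy of G in direction [k] crosses every slice in that direction, including the one disjoint
    from [B]. *)
Lemma lines_not_full B J b :
  (forall i, i \in J -> exists u, pure B (J :\ i) (upd b i u) false) ->
  forall f k, f \in cube J b -> k \in J -> fibG B f k != setT.
Proof.
move=> pJ f k fJ kJ; have [u /pureP pu] := pJ k kJ.
apply/eqP => /setP/(_ u); rewrite !inE pu //.
by rewrite cube_slice // cube_upd // fJ upd_same eqxx.
Qed.

(** Induction on the number of free coordinates; [#|~: J|] compensates for the copies of G in frozen
    directions. With one frozen coordinate it yields delta(H) cut edges per mixed slice. *)
Lemma ecut_ge B J b : nontrivial G -> connected G -> connected H -> mixed B J b ->
  0 < ecut B J b /\ min_deg H < ecut B J b + #|~: J|.
Proof.
move=> ntG cG cH; have [n] := ubnP #|J|; elim: n J B b => // n IHn J B b Jn sp.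
have [J0|J0] := eqVneq J set0.
  (* With no free coordinate, [#|~: J|] is [#|H|], which exceeds every degree, so only positivity is
     at stake. *)
  rewrite J0 setC0 cardsT.
  have /mixedP[[f [k [fJ fk]]] [f' [k' [f'J fk']]]] := sp.
  have fb h : h \in cube J b -> h = b.
    by move=> /cubeP E; apply/ffunP => i; rewrite E // J0 inE.
  have : 0 < ecut B set0 b.
    rewrite /ecut (bigD1 b) ?cube_id //= addn_gt0 addn_gt0 cut_gt0 //.
      by apply/set0Pn; exists k; rewrite inE -(fb f).
    by apply: contra fk' => /eqP/setP/(_ k'); rewrite !inE (fb f').
  have [h <-] := min_deg_attained H; have := deg_ltn h; lia.
have [[i iJ spi]|[c pJ]] := slices_alternative B b J0.
  (* Two mixed slices suffice: the bound for the first is short by the newly frozen coordinate [i],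
     and one edge in the second makes up for it. *)
  have /card_gt1P[u [v [_ _ uv]]] : 1 < #|G| := ntG.
  have Jcard : #|J| = #|J :\ i|.+1 by rewrite (cardsD1 i) iJ.
  have JCcard : #|~: (J :\ i)| = #|~: J|.+1.
    have := cardsC J; have := cardsC (J :\ i); lia.
  have [||eu du] := IHn (J :\ i) B (upd b i u); [lia | exact: spi |].
  have [||ev dv] := IHn (J :\ i) B (upd b i v); [lia | exact: spi |].
  have := ecut_slices B b iJ.
  rewrite (bigD1 u) //= (bigD1 v) 1?eq_sym //=; lia.
wlog E : B c sp pJ / c = false => [wl|]; last rewrite {c}E in pJ.
  case: c pJ => pJ; last exact: (wl B false).
  rewrite -ecut_setC; apply: (wl _ false); rewrite ?mixed_setC // => i iJ.
  by have [u] := pJ i iJ; exists u; rewrite pure_setC.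
have nfull := lines_not_full pJ.
have /mixedP[[f [k [fJ fk]]] _] := sp.
have T0 : fibH B f != set0 by apply/set0Pn; exists k; rewrite inE.
(* Each vertex of the trace in a free direction lies on its own copy of G, which is cut because it
   meets [B] and is not full. *)
have lb : cut (fibH B f) + #|fibH B f :&: J| <= ecut B J b.
  rewrite (ecut_base B J b f) (bigD1 f) //=; apply: leq_trans (leq_addr _ _).
  rewrite leq_add2l -sum1_card (eq_bigl (fun l => (l \in J) && (l \in fibH B f))).
    rewrite [leqRHS](eq_bigl (mem J)); last by move=> l; rewrite eqxx andbT.
    rewrite big_mkcondr /=; apply: leq_sum => l lJ; rewrite inE; case: ifP => // fl.
    apply: cut_gt0 => //; last exact: nfull.
    by apply/set0Pn; exists (f l); rewrite fibG_mem.
  by move=> l; rewrite inE andbC.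
have := cut_min_deg T0; have := cardsID J (fibH B f).
have : #|fibH B f :\: J| <= #|~: J| by apply/subset_leq_card/subsetP => l; rewrite !inE => /andP[].
(* A full trace meets [J] since [J] is nonempty; a proper one is itself cut. *)
have : 0 < cut (fibH B f) \/ 0 < #|fibH B f :&: J|.
  have [->|T1] := eqVneq (fibH B f) setT; last by left; apply: cut_gt0.
  by right; rewrite setTI card_gt0.
lia.
Qed.

End ExpCut.

Lemma leq_sum_at (I : finType) (w : I -> nat) (i : I) (S : {set I}) :
  i \notin S -> (forall j, j \in S -> 0 < w j) ->
  w i + #|S| <= \sum_j w j.
Proof.
move=> iS w0; rewrite (bigD1 i) //= leq_add2l -sum1_card.
rewrite big_mkcond [leqRHS]big_mkcond /=; apply: leq_sum => j _.
case: ifP => [jS|_] //; rewrite ifT ?w0 //.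
by apply: contraNneq iS => <-.
Qed.

(** * Sufficiency: small cuts of the exponential graph isolate a vertex *)

Section Main.
Variables G H : sgraph.
Local Notation F := {ffun H -> G}.
Local Notation X := (exp_graph G H).
Implicit Types (f g : F) (k l j : H) (u v : G) (B : {set X}).
Hypotheses (ntG : nontrivial G) (ntH : nontrivial H).
Hypotheses (cG : connected G) (cH : connected H).

(* The cut edges charged to [f] when the copies of [G] are represented as in
   [ecut_base]. *)
Definition wt B g f :=
  cut (fibH B f) + \sum_(l | f l == g l) cut (fibG B f l).

Lemma cut_wt B g : cut B = \sum_f wt B g f.
Proof.
rewrite (cut_ecut B g) (ecut_base B setT g g).
apply: eq_big => [f|f _]; first exact: cubeT.
by congr (_ + _); apply: eq_bigl => l; rewrite inE.
Qed.

Lemma wt_base B g : wt B g g = cut (fibH B g) + \sum_l cut (fibG B g l).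
Proof. by rewrite /wt; congr (_ + _); apply: eq_bigl => l; rewrite eqxx. Qed.

Lemma nontrivial_exp : nontrivial X.
Proof.
have /card_gt0P[u _] := svertex_gt0 G.
have /card_gt1P[j [k [_ _ jk]]] : 1 < #|H| := ntH.
by apply/card_gt1P; exists ([ffun=> u], j), ([ffun=> u], k); split=> //; apply: contraNneq jk => -[->].
Qed.

Section NoFullLine.
Variable B : {set X}.
Hypothesis nfull : forall f k, fibG B f k != setT.

Lemma line_cut_gt0 f k : ((f, k) : X) \in B -> 0 < cut (fibG B f k).
Proof.
move=> fk; apply: cut_gt0 => //.
by apply/set0Pn; exists (f k); rewrite fibG_mem.
Qed.

Lemma copy_cut_gt0 f k :
  ((f, k) : X) \in B -> fibH B f != setT -> 0 < cut (fibH B f).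
Proof. by move=> fk; apply: cut_gt0 => //; apply/set0Pn; exists k; rewrite inE. Qed.

(* If the neighbour [upd g k u] of the copy [g] lies in [B] across direction [k],
   then either its copy of [H] is cut, or it is full and all the copies of [G]
   through it are cut, including those in a direction [l != k], which do not
   meet [g]. *)
Lemma cut_full_copy g : fibH B g = setT -> #|H| * min_deg G <= cut B.
Proof.
move=> gT; have gB k : ((g, k) : X) \in B by move/setP/(_ k): gT; rewrite !inE.
(* Members of [B] one G-edge or more along the lines through [g], off [g] itself; [S] collects their
   tuples, each to be charged a cut edge. *)
pose D := [set z : H * G | z.2 \in fibG B g z.1 :\ g z.1].
pose S := [set upd g z.1 z.2 | z in D].
have cS : #|S| = \sum_k #|fibG B g k :\ g k|.
  rewrite card_in_imset => [|[k u] [l v]].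
    rewrite -sum1_card (eq_bigl (fun z : H * G => true && (z.2 \in fibG B g z.1 :\ g z.1))).
      rewrite -(pair_big_dep xpredT (fun k u => u \in fibG B g k :\ g k) (fun _ _ => 1)) /=.
      by apply: eq_bigr => k _; rewrite sum1_card.
    by move=> z; rewrite inE.
  rewrite !inE /= => /andP[ug _] /andP[vg _] E.
  have kl : k = l.
    apply/eqP; apply: contraNT ug => kl.
    by move/(congr1 (fun h : F => h k)): E; rewrite upd_same upd_other // => ->.
  by move/(congr1 (fun h : F => h k)): E; rewrite -kl !upd_same => ->.
rewrite (cut_wt B g); apply: leq_trans (leq_sum_at (S := S) (i := g) _ _).
- rewrite cS wt_base -addnA; apply: leq_trans (leq_addl _ _).
  (* Direction [k] provides the cut of its line plus one edge per further member of [B] on it,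
     together at least delta(G). *)
  rewrite -sum_nat_const -big_split /=; apply: leq_sum => k _.
  have Uk : g k \in fibG B g k by rewrite fibG_mem.
  have U0 : fibG B g k != set0 by apply/set0Pn; exists (g k).
  have := cut_min_deg U0; rewrite (cardsD1 (g k) (fibG B g k)) Uk; lia.
- apply/negP => /imsetP[[k u]]; rewrite !inE /= => /andP[ug _] E.
  by move/negP: ug; rewrite E upd_same.
move=> h /imsetP[[k u]]; rewrite !inE /= => /andP[ug ukB] ->.
rewrite /wt; have [hT|hT] := eqVneq (fibH B (upd g k u)) setT; last first.
  by rewrite addn_gt0 (copy_cut_gt0 ukB).
have [l lk] : exists l, l != k.
  have /card_gt1P[j [l [_ _ jl]]] : 1 < #|H| := ntH.
  have [jk|] := eqVneq j k; last by exists j.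
  by exists l; rewrite -jk eq_sym.
rewrite (bigD1 l) /=; last by rewrite upd_other.
rewrite addn_gt0 addn_gt0 line_cut_gt0 ?orbT //.
by move/setP/(_ l): hT; rewrite !inE.
Qed.

(** Around a vertex [(f, j)] of [B], the traces [T] and [U] give delta(H) + delta(G) cut edges:
    their own cuts, one per other vertex of [T] (a cut copy of G), one per other vertex of [U] (a
    cut copy of H). [cut_min_degS] makes this strict if a trace has a second vertex. *)
Lemma cut_no_full_copy : (forall f, fibH B f != setT) -> B != set0 ->
  cut B <= min_deg G + min_deg H -> exists x, B = [set x].
Proof.
move=> nfullH /set0Pn[[f j] fj] cB.
set T := fibH B f; set U := fibG B f j.
have jT : j \in T by rewrite inE.
have fU : f j \in U by rewrite fibG_mem.
have wf : cut T + cut U + #|T :\ j| <= wt B f f.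
  rewrite wt_base -addnA leq_add2l.
  apply: leq_trans (leq_sum_at (S := T :\ j) (i := j) _ _) => //.
    by rewrite !inE eqxx.
  by move=> l; rewrite !inE => /andP[_]; apply: line_cut_gt0.
pose S := [set upd f j u | u in U :\ f j].
have cS : #|S| = #|U :\ f j|.
  by apply: card_imset => u v /(congr1 (fun h : F => h j)); rewrite !upd_same.
have fS : f \notin S.
  apply/negP => /imsetP[u]; rewrite !inE => /andP[uf _] E.
  by move/negP: uf; rewrite E upd_same.
have wS h : h \in S -> 0 < wt B f h.
  case/imsetP=> u; rewrite !inE => /andP[_ uB] ->.
  by rewrite addn_gt0 (copy_cut_gt0 uB).
have lbS := leq_sum_at fS wS; rewrite -(cut_wt B f) cS in lbS.
have T0 : T != set0 by apply/set0Pn; exists j.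
have U0 : U != set0 by apply/set0Pn; exists (f j).
have dT := cut_min_deg T0; have dU := cut_min_deg U0.
have dT2 := cut_min_degS cH (nfullH f); have dU2 := cut_min_degS cG (nfull f j).
rewrite -/T -/U in dT2 dU2.
have eT := cardsD1 j T; have eU := cardsD1 (f j) U; rewrite jT fU in eT eU.
have T1 : #|T| = 1 by apply/eqP; rewrite eqn_leq leqNgt card_gt0 T0 andbT; apply/negP => ?; lia.
have /cards1P[j0 Ej] : #|T| == 1 by rewrite T1.
have {j0}Ej : T = [set j] by move: jT; rewrite Ej inE => /eqP->.
exists (f, j); apply/eqP; rewrite eqEsubset sub1set fj andbT; apply/subsetP => -[g k] gk.
have [gf|gf] := eqVneq g f.
  have kT : k \in T by rewrite inE -gf.
  by rewrite Ej inE in kT; rewrite gf (eqP kT) inE.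
(* A further tuple [g] meeting [B] has a cut copy of H, one edge too many if [U] is a singleton; a
   larger [U] is excluded by [dU2]. *)
have : wt B f f + #|[set g]| <= \sum_h wt B f h.
  apply: leq_sum_at => [|h]; first by rewrite inE eq_sym.
  by rewrite inE => /eqP->; rewrite addn_gt0 (copy_cut_gt0 gk).
rewrite -(cut_wt B f) cards1; lia.
Qed.

End NoFullLine.

Lemma cut_exp_super B :
  min_deg G + min_deg H < #|G| * min_deg H ->
  min_deg G + min_deg H < #|H| * min_deg G ->
  B != set0 -> B != setT -> cut B <= min_deg X ->
  exists x, B = [set x] \/ ~: B = [set x].
Proof.
rewrite min_deg_exp => Gd Hd B0 BT cB.
have /card_gt0P[u0 _] := svertex_gt0 G.
pose b : F := [ffun=> u0].
have HT : [set: H] != set0 by rewrite -card_gt0 cardsT svertex_gt0.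
have [[i _ spi]|[c pJ]] := slices_alternative B b HT.
  have : #|G| * min_deg H <= cut B; last lia.
  rewrite (cut_ecut B b); apply: leq_trans (ecut_slices B b (in_setT i)).
  rewrite -sum_nat_const; apply: leq_sum => u _.
  have [_] := ecut_ge ntG cG cH (spi u).
  by rewrite setTD setCK cards1 addn1 ltnS.
have main A : A != set0 -> cut A <= min_deg G + min_deg H ->
    (forall i, i \in setT -> exists u, pure A (setT :\ i) (upd b i u) false) ->
    exists x, A = [set x].
  move=> A0 cA pA.
  have nfull f k : fibG A f k != setT by apply: (lines_not_full pA); rewrite ?cubeT.
  apply: cut_no_full_copy => // f; apply/eqP => fT.
  by have := cut_full_copy nfull fT; lia.
(* If the pure slices lie in [B], the argument runs on the complement. *)
case: c pJ => pJ; last by have [x ->] := main B B0 cB pJ; exists x; left.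
have [|||x Ex] := main (~: B); last by exists x; right.
- by apply: contra BT => /eqP E; rewrite -(setCK B) E setC0.
- by rewrite cut_setC.
by move=> i /pJ[u pu]; exists u; rewrite pure_setC.
Qed.

(** * Necessity: separating a copy of H or of G *)

Lemma super_exp_copyH : super_edge_connected X -> complete H -> 1 < min_deg G.
Proof.
move=> sX kH; rewrite ltnNge; apply/negP => dG1.
have dG : min_deg G = 1 by apply/eqP; rewrite eqn_leq dG1 min_deg_gt0.
have [v dv] := min_deg_attained G; pose f : F := [ffun=> v].
(* The copy of H at a constant tuple whose value [v] has degree 1: each vertex has one edge out, so
   the cut has [#|H|] = delta(H) + 1 edges. *)
pose A : {set X} := [set ((f, k) : X) | k in H].
have Af k : ((f, k) : X) \in A by apply: imset_f.
have AN g k : ((g, k) : X) \in A -> g = f by case/imsetP=> l _ [].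
have /card_gt0P[w] : 0 < deg v by rewrite dv dG.
rewrite inE => vw.
have fN k : ((upd f k w, k) : X) \notin A.
  apply/negP => /AN/(congr1 (fun h : F => h k)); rewrite upd_same ffunE => wv.
  by rewrite wv sedge_irr in vw.
have /card_gt1P[j [k [_ _ jk]]] : 1 < #|H| := ntH.
have bd l : [set ((f, l) : X); (upd f l w, l)] \in boundary A.
  by apply/imset2P; exists (f, l) (upd f l w, l) => //; rewrite in_setD fN inE adjG ffunE.
have [|||[g l] Eb] := super_boundary (A := A) sX nontrivial_exp.
- by apply/set0Pn; exists (f, j).
- by apply: contraNneq (fN j) => ->.
- rewrite min_deg_exp dG add1n complete_min_deg // /cut.
  rewrite -[leqRHS]muln1 -[X in _ <= X * _](card_imset (mem H) (f := fun k => (f, k) : X)); last by move=> ? ? [].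
  rewrite -sum_nat_const; apply: leq_sum => x /imsetP[l _ ->].
  rewrite nbr_expD (_ : fibH A f = setT); last by apply/setP => l'; rewrite !inE Af.
  rewrite setDT cards0 -dG -dv ffunE; apply/subset_leq_card/subsetDl.
(* Both ends of the boundary edge at [m] have second component [m], so the centre of a star would
   have every [m] as its second component. *)
have inb m : l = m.
  have := bd m; rewrite Eb => /imsetP[y _ E].
  have := set21 ((g, l) : X) y; rewrite -E !inE => /orP[]/eqP[] //.
by rewrite -(inb j) -(inb k) eqxx in jk.
Qed.

(** Dual separation: a copy of G in a direction [j] of degree 1. Both ends of a boundary edge share
    their tuple, so a star centre would have to carry all tuples [upd f j w] at once. *)
Lemma super_exp_copyG : super_edge_connected X -> complete G -> 1 < min_deg H.
Proof.
move=> sX kG; rewrite ltnNge; apply/negP => dH1.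
have dH : min_deg H = 1 by apply/eqP; rewrite eqn_leq dH1 min_deg_gt0.
have [j dj] := min_deg_attained H.
have /card_gt1P[u [v [_ _ uv]]] : 1 < #|G| := ntG.
pose f : F := [ffun=> u].
pose A : {set X} := [set ((upd f j w, j) : X) | w in G].
have Af w : ((upd f j w, j) : X) \in A by apply: imset_f.
have AN g k : ((g, k) : X) \in A -> k = j by case/imsetP=> l _ [].
have /card_gt0P[k] : 0 < deg j by rewrite dj dH.
rewrite inE => jk.
have fN w : ((upd f j w, k) : X) \notin A.
  by apply/negP => /AN kj; rewrite kj sedge_irr in jk.
have bd w : [set ((upd f j w, j) : X); (upd f j w, k)] \in boundary A.
  by apply/imset2P; exists (upd f j w, j) (upd f j w, k) => //; rewrite in_setD fN inE adjH.
have [|||[g l] Eb] := super_boundary (A := A) sX nontrivial_exp.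
- by apply/set0Pn; exists (upd f j u, j).
- by apply: contraNneq (fN u) => ->.
- rewrite min_deg_exp dH addn1 complete_min_deg // /cut.
  rewrite -[leqRHS]muln1 -[X in _ <= X * _](card_imset (mem G) (f := fun w => (upd f j w, j) : X)); last first.
    by move=> ? ? [/(congr1 (fun h : F => h j))]; rewrite !upd_same.
  rewrite -sum_nat_const; apply: leq_sum => x /imsetP[w _ ->].
  rewrite nbr_expD (_ : fibG A _ _ = setT); last by apply/setP => w'; rewrite !inE upd_upd Af.
  by rewrite setDT cards0 addn0 -dH -dj; apply/subset_leq_card/subsetDl.
have inb w : g = upd f j w.
  have := bd w; rewrite Eb => /imsetP[y _ E].
  by have := set21 ((g, l) : X) y; rewrite -E !inE => /orP[]/eqP[].
have := inb u; rewrite (inb v) => /(congr1 (fun h : F => h j)).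
by rewrite !upd_same => E; rewrite E eqxx in uv.
Qed.

End Main.

(** [#|H|] is at least delta(H) + 1, and at least delta(H) + 2 when H is not complete; either
    alternative then gives strictness. *)
Lemma min_deg_mul (G H : sgraph) : nontrivial H -> 0 < min_deg G ->
  (2 <= min_deg G \/ ~ complete H) ->
  min_deg G + min_deg H < #|H| * min_deg G.
Proof.
rewrite /nontrivial => ntH dG C; have dH : min_deg H < #|H|.
  by have [u <-] := min_deg_attained H; exact: deg_ltn.
case: C => [|/not_complete_min_deg]; nia.
Qed.

Theorem theorem6 (G H : sgraph)
    (ntG : nontrivial G) (ntH : nontrivial H)
    (cG : connected G) (cH : connected H) :
  super_edge_connected (exp_graph G H) <->
    ((2 <= min_deg G \/ ~ complete H) /\ (2 <= min_deg H \/ ~ complete G)).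
Proof.
split=> [sX|[CG CH]].
  split.
    case: (boolP (complete H)) => [kH|kH]; last by right; apply/negP.
    by left; apply: (super_exp_copyH ntG ntH cG sX).
  case: (boolP (complete G)) => [kG|kG]; last by right; apply/negP.
  by left; apply: (super_exp_copyG ntG ntH cH sX).
have dG := min_deg_mul ntH (min_deg_gt0 ntG cG) CG.
have dH := min_deg_mul ntG (min_deg_gt0 ntH cH) CH.
apply: super_edge_connected_cut; first exact: nontrivial_exp.
by move=> A; apply: cut_exp_super => //; rewrite addnC.
Qed.
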